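(* Let $\mathcal{H}_1$ and $\mathcal{H}_2$ be two real Hilbert spaces, and let $C\subset\mathcal{H}_1$ and $Q\subset\mathcal{H}_2$ be nonempty, closed and convex subsets. Let $X$ be a finite-dimensional Banach space, and let $\varphi:\mathcal{H}_1\times X\to\mathbb{R}$ and $\psi:\mathcal{H}_2\times X\to\mathbb{R}$ be two continuous functions. Let $\mathcal{B}_1:\mathcal{H}_1\times X\to 2^{\mathcal{H}_1}$ and $\mathcal{B}_2:\mathcal{H}_2\times X\to 2^{\mathcal{H}_2}$ be two strict weakly compact-valued and $H$-continuous mappings, and let $A:\mathcal{H}_1\to\mathcal{H}_2$ be a bounded linear operator. Then the family $\mathcal{PSMVIP}$ of parametric split multivalued variational inequality problems associated with these data is LP well-posed in the generalized sense if and only if for each $p\in X$, $$S_p(\delta,\epsilon)\neq\emptyset \quad \forall\,\delta,\epsilon>0 \quad\text{and}\quad \mu(S_p(\delta,\epsilon))\to 0 \text{ as } (\delta,\epsilon)\to(0,0).$$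
   Context: Data: real Hilbert spaces $\mathcal{H}_1,\mathcal{H}_2$; sets $C\subset\mathcal{H}_1$, $Q\subset\mathcal{H}_2$; a Banach space $X$; functions $\varphi:\mathcal{H}_1\times X\to\mathbb{R}$, $\psi:\mathcal{H}_2\times X\to\mathbb{R}$; multivalued mappings $\mathcal{B}_i:\mathcal{H}_i\times X\to 2^{\mathcal{H}_i}$ ($i=1,2$); a bounded linear operator $A:\mathcal{H}_1\to\mathcal{H}_2$. The product $\mathcal{H}_1\times\mathcal{H}_2$ carries its usual Hilbert space structure. A multivalued mapping is strict if all its values are nonempty. It is weakly compact-valued if each of its values is a weakly compact set. Hausdorff metric: for nonempty sets $M,N$ in a Hilbert space, $d(a,N)=\inf_{b\in N}\|a-b\|$, $D(M,N)=\sup_{a\in M}d(a,N)$, $H(M,N)=\max\{D(M,N),D(N,M)\}$. A strict weakly compact-valued mapping $B:\mathcal{H}\times X\to 2^{\mathcal{H}}$ is $H$-continuous if for every $(x,p)\in\mathcal{H}\times X$ and every $\epsilon>0$ there is $\delta>0$ such that $H(B(x,p),B(y,q))<\epsilon$ for all $(y,q)\in\mathcal{H}\times X$ with $\|(x,p)-(y,q)\|<\delta$ (product norm). For $p\in X$, problem (PSMVIP$_p$) is: find $(x^*,y^* )\in\mathcal{H}_1\times\mathcal{H}_2$ for which there exists $(u^*,v^* )\in\mathcal{B}_1(x^*,p)\times\mathcal{B}_2(y^*,p)$ such that $x^*\in C$, $y^*\in Q$, $y^*=Ax^*$, $\langle u^*,x^*-x\rangle+\varphi(x^*,p)-\varphi(x,p)\le0$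 for all $x\in C$, and $\langle v^*,y^*-y\rangle+\psi(y^*,p)-\psi(y,p)\le0$ for all $y\in Q$. Its solution set is $S_p$. $\mathcal{PSMVIP}$ denotes the family of problems $\{(\mathrm{PSMVIP}_p):p\in X\}$. Let $p\in X$ and $\{p_n\}\subset X$ with $p_n\to p$. A sequence $\{(x_n,y_n)\}\subset\mathcal{H}_1\times\mathcal{H}_2$ is a generalized approximating sequence for (PSMVIP$_p$) corresponding to $\{p_n\}$ if there exist $u_n\in\mathcal{B}_1(x_n,p_n)$, $v_n\in\mathcal{B}_2(y_n,p_n)$ and real numbers $\epsilon_n>0$ with $\epsilon_n\to0$ such that, for every $n$, $d(x_n,C)\le\epsilon_n$, $d(y_n,Q)\le\epsilon_n$, $\|y_n-Ax_n\|\le\epsilon_n$, $\langle u_n,x_n-x\rangle+\varphi(x_n,p_n)-\varphi(x,p_n)\le\epsilon_n$ for all $x\in C$, and $\langle v_n,y_n-y\rangle+\psi(y_n,p_n)-\psi(y,p_n)\le\epsilon_n$ for all $y\in Q$. $\mathcal{PSMVIP}$ is LP (Levitin-Polyak) well-posed in the generalized sense if for each $p\in X$, $S_p$ is nonempty and for each sequence $\{p_n\}\subset X$ with $p_n\to p$, every generalized approximating sequence for (PSMVIP$_p$) corresponding to $\{p_n\}$ has a subsequence which converges (in norm) to some element of $S_p$. For $p\in X$ and $\delta,\epsilon>0$, $S_p(\delta,\epsilon)$ is the union, over all $q$ in the closed ball $\mathbb{B}(p,\delta)\subset X$ of center $p$ and radius $\delta$, of the sets of all $(z,w)\in\mathcal{H}_1\times\mathcal{H}_2$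 such that $d(z,C)\le\epsilon$, $d(w,Q)\le\epsilon$, $\|w-Az\|\le\epsilon$, and there exist $u\in\mathcal{B}_1(z,q)$, $v\in\mathcal{B}_2(w,q)$ with $\langle u,z-x\rangle+\varphi(z,q)-\varphi(x,q)\le\epsilon$ for all $x\in C$ and $\langle v,w-y\rangle+\psi(w,q)-\psi(y,q)\le\epsilon$ for all $y\in Q$. The Kuratowski measure of noncompactness of a set $M$ is $\mu(M)=\inf\{\epsilon>0: M\subset\bigcup_{i=1}^n M_i \text{ for some } n\in\mathbb{N} \text{ and sets } M_i \text{ with } \operatorname{diam}(M_i)<\epsilon,\ i=1,\dots,n\}$ (equal to $+\infty$ if no such $\epsilon$ exists), where $\operatorname{diam}(M)=\sup\{\|a-b\|:a,b\in M\}$. *)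

(* Defs.v *)
From HB Require Import structures.
From mathcomp Require Import all_boot all_order all_algebra.
From mathcomp Require Import all_classical all_reals all_analysis.

Set Implicit Arguments.
Unset Strict Implicit.
Unset Printing Implicit Defensive.

Import Order.TTheory GRing.Theory Num.Theory.
Import numFieldNormedType.Exports.

Local Open Scope classical_set_scope.
Local Open Scope ring_scope.

HB.mixin Record CompleteNormedModule_isHilbert (R : realType) H
    of CompleteNormedModule R H := {
  inner : {dot H for (@idfun R)} ;
  normr_inner : forall x : H, `|x| ^+ 2 = inner x x
}.

#[short(type="hilbertType")]
HB.structure Definition Hilbert (R : realType) :=
  {H of CompleteNormedModule_isHilbert R H & CompleteNormedModule R H}.

Section normed_spaces.
Context {R : realType}.

Definition finite_dimensional (X : normedModType R) : Prop :=
  exists n (e : 'I_n -> X), forall x, exists c : 'I_n -> R,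
    x = \sum_(i < n) c i *: e i.

Definition bounded_linear (U V : normedModType R) (A : {linear U -> V}) : Prop :=
  exists k : R, forall x, `|A x| <= k * `|x|.

Definition topological_dual (V : normedModType R) : Type :=
  {f : {linear V -> R^o} | continuous f}.

Definition weak_topology (V : normedModType R) : topologicalType :=
  sup_topology (fun f : topological_dual V =>
    Topological.on (initial_topology (sval f : V -> R^o))).

Definition weakly_compact (V : normedModType R) (M : set V) : Prop :=
  @compact (weak_topology V) M.

(* Distances between sets are extended reals, so that no supremum or infimum
   is taken of an unbounded or empty set of reals. *)
Definition set_dist (V : normedModType R) (a : V) (N : set V) : \bar R :=
  ereal_inf [set `|a - b|%:E | b in N].

Definition excess (V : normedModType R) (M N : set V) : \bar R :=
  ereal_sup [set set_dist a N | a in M].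

Definition hausdorff_dist (V : normedModType R) (M N : set V) : \bar R :=
  maxe (excess M N) (excess N M).

(* The norm is a parameter because the normed space structure that the library
   puts on a product is that of the maximum norm, see [hprod_norm] below.
   [diam nrm set0] is -oo, which is below every positive bound, as 0 is. *)
Definition diam (V : zmodType) (nrm : V -> R) (M : set V) : \bar R :=
  ereal_sup [set (nrm (ab.1 - ab.2))%:E | ab in M `*` M].

Definition kuratowski (V : zmodType) (nrm : V -> R) (M : set V) : \bar R :=
  ereal_inf [set e%:E | e in [set e : R | 0 < e /\
    exists (n : nat) (M_ : 'I_n -> set V),
      M `<=` \bigcup_i M_ i /\ forall i, (diam nrm (M_ i) < e%:E)%E]].

End normed_spaces.

Section multivalued_mappings.
Context {R : realType} (H : hilbertType R) (X : completeNormedModType R).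
Implicit Type B : H * X -> set H.

Definition strict B : Prop := forall xp, B xp !=set0.

Definition weakly_compact_valued B : Prop := forall xp, weakly_compact (B xp).

Definition H_continuous B : Prop :=
  forall (xp : H * X) (e : R), 0 < e -> exists2 d : R, 0 < d &
    forall yq : H * X, `|xp - yq| < d ->
      (hausdorff_dist (B xp) (B yq) < e%:E)%E.

End multivalued_mappings.

(* The Hilbert norm of the product. It induces the product topology, so that
   the library's [-->] on [H1 * H2] is convergence in this norm. *)
Definition hprod_norm {R : realType} (H1 H2 : hilbertType R) (z : H1 * H2) : R :=
  Num.sqrt (`|z.1| ^+ 2 + `|z.2| ^+ 2).

Section PSMVIP.
Context {R : realType} {H1 H2 : hilbertType R} {X : completeNormedModType R}.
Variables (C : set H1) (Q : set H2).
Variables (phi : H1 * X -> R) (psi : H2 * X -> R).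
Variables (B1 : H1 * X -> set H1) (B2 : H2 * X -> set H2).
Variable A : {linear H1 -> H2}.
Implicit Types (p q : X) (z : H1 * H2).

Definition variational_ineqs q (e : R) z (u : H1) (v : H2) : Prop :=
  (forall x, C x -> inner u (z.1 - x) + phi (z.1, q) - phi (x, q) <= e) /\
  (forall y, Q y -> inner v (z.2 - y) + psi (z.2, q) - psi (y, q) <= e).

Definition PSMVIP_sol p : set (H1 * H2) :=
  [set z | exists u v, (B1 (z.1, p) u /\ B2 (z.2, p) v) /\
    [/\ C z.1, Q z.2, z.2 = A z.1 & variational_ineqs p 0 z u v]].

Definition approx_ineqs q (e : R) z (u : H1) (v : H2) : Prop :=
  [/\ (set_dist z.1 C <= e%:E)%E, (set_dist z.2 Q <= e%:E)%E,
      `|z.2 - A z.1| <= e & variational_ineqs q e z u v].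

Definition gen_approx_seq p (p_ : nat -> X) (z_ : nat -> H1 * H2) : Prop :=
  p_ @ \oo --> p /\
  exists (u_ : nat -> H1) (v_ : nat -> H2) (e_ : nat -> R),
    [/\ forall n, B1 ((z_ n).1, p_ n) (u_ n) /\ B2 ((z_ n).2, p_ n) (v_ n),
        forall n, 0 < e_ n,
        e_ @ \oo --> (0 : R) &
        forall n, approx_ineqs (p_ n) (e_ n) (z_ n) (u_ n) (v_ n)].

Definition LP_well_posed_gen : Prop :=
  forall p, PSMVIP_sol p !=set0 /\
    forall (p_ : nat -> X), p_ @ \oo --> p ->
    forall (z_ : nat -> H1 * H2), gen_approx_seq p p_ z_ ->
    exists f : nat -> nat, {homo f : m n / (m < n)%N} /\
      exists2 z, PSMVIP_sol p z & (z_ \o f) @ \oo --> z.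

Definition approx_sol p (d e : R) : set (H1 * H2) :=
  \bigcup_(q in closed_ball_ Num.norm p d)
    [set z | exists u v, (B1 (z.1, q) u /\ B2 (z.2, q) v) /\
                         approx_ineqs q e z u v].

End PSMVIP.

(* Main.v *)
Require Import Defs.
From HB Require Import structures.
From mathcomp Require Import all_boot all_order all_algebra.
From mathcomp Require Import all_classical all_reals all_analysis.
From mathcomp Require Import lra.

Set Implicit Arguments.
Unset Strict Implicit.
Unset Printing Implicit Defensive.

Import Order.TTheory GRing.Theory Num.Theory.
Import numFieldNormedType.Exports.

Local Open Scope classical_set_scope.
Local Open Scope ring_scope.

(** Both directions rest on the observation that a generalized approximating
sequence is, up to finitely many terms, a sequence that runs through the sets
S_p(d, e) with d and e arbitrarily small ([gen_approx_seq_approx_sol]), and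
that conversely any choice of points z_n in S_p(1/(n+1), 1/(n+1)) is such a
sequence ([approx_sol_gen_approx_seq]).

If the family is well-posed, then S_p is nonempty and contained in every
S_p(d, e). For each r > 0 some S_p(1/(n+1), 1/(n+1)) is covered by finitely
many balls of radius r: otherwise one chooses z_n in these sets with pairwise
distances at least r ([exists_separated_seq]), a generalized approximating
sequence without convergent subsequence. This bounds the measure of
noncompactness of all smaller S_p(d, e).

Conversely, let (z_n) be a generalized approximating sequence and U an
ultrafilter that refines the filter of final segments of the natural numbers.
Since the tails of (z_n) have finite covers by sets of arbitrarily small
diameter, U contains one set of each cover, so that z_n is Cauchy along U and
has a limit z = (x, y) ([ultra_totally_bounded_cvg]). The point z is in S_p
([gen_approx_seq_limit]): by continuity of B_1 in the Hausdorff distance, u_n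
is asymptotic in norm to some w_n in the weakly compact set B_1(x, p), w_n
converges weakly along U to some u in B_1(x, p), and w_n is bounded by the
uniform boundedness principle, so that <u_n, x_n - x'> tends to <u, x - x'> for
every x' ([variational_ineq_limit]); the same holds for B_2. Finally z is a
cluster point of (z_n), hence the limit of a subsequence
([subseq_cvg_of_cluster]). Applied to points chosen in the nonempty sets
S_p(1/(n+1), 1/(n+1)), this also shows that S_p is nonempty. *)

(** * Inner product and weak topology *)

Section inner_product.
Context {R : realType} {H : hilbertType R}.
Implicit Types u v w : H.

Lemma innerC u v : inner u v = inner v u.
Proof. by rewrite hermC expr0 mul1r. Qed.

Lemma innerDl u v w : inner (u + v) w = inner u w + inner v w.
Proof. exact: linearDl. Qed.

Lemma innerZl k u w : inner (k *: u) w = k * inner u w.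
Proof. exact: linearZl_LR. Qed.

Lemma innerBl u v w : inner (u - v) w = inner u w - inner v w.
Proof. by rewrite -scaleN1r innerDl innerZl mulN1r. Qed.

Lemma innerDr u v w : inner u (v + w) = inner u v + inner u w.
Proof. by rewrite ![inner u _]innerC innerDl. Qed.

Lemma innerZr k u v : inner u (k *: v) = k * inner u v.
Proof. by rewrite ![inner u _]innerC innerZl. Qed.

Lemma innerBr u v w : inner u (v - w) = inner u v - inner u w.
Proof. by rewrite ![inner u _]innerC innerBl. Qed.

Lemma inner0r u : inner u 0 = 0.
Proof. by have := innerZr 0 u 0; rewrite scaler0 mul0r. Qed.

(** The Cauchy-Schwarz inequality. *)
Lemma normr_inner_le u v : `|inner u v| <= `|u| * `|v|.
Proof.
rewrite -(@ler_pXn2r _ 2) ?nnegrE ?mulr_ge0// exprMn real_normK ?num_real//.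
have [->|v0] := eqVneq v 0.
  by rewrite inner0r !normr0 expr0n mulr0.
have vv : 0 < inner v v by rewrite -normr_inner exprn_gt0 ?normr_gt0.
(* expand the squared norm of <v, v> u - <u, v> v *)
have : 0 <= `|inner v v *: u - inner u v *: v| ^+ 2 by rewrite exprn_ge0.
rewrite !normr_inner !(innerBl, innerBr, innerZl, innerZr) (innerC v u).
move: (inner u u) (inner u v) (inner v v) vv => a b c c0 h.
rewrite -(ler_pM2l c0); lra.
Qed.

End inner_product.

Section weak.
Context {R : realType} {H : hilbertType R}.

Lemma continuous_inner_l (v : H) : continuous (fun w : H => inner w v : R^o).
Proof.
move=> w; apply/(@cvgrPdist_le _ R^o) => e e0; near=> x.
rewrite -innerBl (le_trans (normr_inner_le _ _))//.
apply: (@le_trans _ _ (`|w - x| * (`|v| + 1))).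
  by rewrite ler_wpM2l// lerDl.
rewrite -ler_pdivlMr ?ltr_wpDl//.
by near: x; apply: cvgr_dist_le => //; rewrite divr_gt0 ?ltr_wpDl.
Unshelve. all: by end_near. Qed.

Lemma weakly_continuous_inner (v : H) :
  continuous (fun w : weak_topology H => inner w v : R).
Proof.
have lf : linear (fun w : H => inner w v : R^o).
  by move=> k x y; rewrite innerDl innerZl.
pose f : {linear H -> R^o} := HB.pack (fun w : H => inner w v : R^o)
  (GRing.isLinear.Build R H R^o _ _ lf).
have cf : continuous f by exact: continuous_inner_l.
pose df : topological_dual H := exist (fun f : {linear H -> R^o} => continuous f) f cf.
move=> w; move: (@cvg_id _ (nbhs (w : weak_topology H))) => /cvg_sup.
move=> /(_ df) h.
have := @initial_continuous H R^o (f : H -> R^o) w.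
exact: (cvg_trans (cvg_app _ h)).
Qed.

(** The functionals <w, .>, for w in M, are pointwise bounded because the image
of M under the weakly continuous map <., h> is compact; the uniform boundedness
principle then bounds their norms, which are those of the w. *)
Lemma weakly_compact_normr_bounded (M : set H) : weakly_compact M ->
  exists k, forall w, M w -> `|w| <= k.
Proof.
move=> Mc.
pose F : set (H -> R^o) := [set (fun h => inner w h : R^o) | w in M].
have Flin f : F f -> bounded_fun_norm f /\ linear f.
  move=> [w Mw <-]; split; last by move=> k x y; rewrite innerDr innerZr.
  move=> r; exists (`|w| * r) => x xr.
  by rewrite (le_trans (normr_inner_le _ _))// ler_wpM2l.
have Fptw : pointwise_bounded F.
  move=> h.
  have : compact ((fun w : weak_topology H => inner w h : R^o) @` M).
    apply: (@continuous_compact (weak_topology H) R^o) => //.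
    exact: (@continuous_subspaceT (weak_topology H) R^o _ _
      (@weakly_continuous_inner h)).
  move/compact_bounded => [k [_ kP]]; exists (k + 1) => f [w Mw <-].
  by apply: (kP (k + 1)); [rewrite ltrDl|exists w].
have [k kP] := Banach_Steinhauss Flin Fptw 1.
exists k => w Mw.
have [->|w0] := eqVneq w 0.
  rewrite normr0 -(@normr0 _ R^o).
  rewrite -[X in `|X|](inner0r w).
  by apply: (kP (fun h => inner w h : R^o)); [exists w|rewrite normr0].
(* the functional of [w] attains its norm at the unit vector along [w] *)
have : `|inner w (`|w|^-1 *: w)| <= k.
  apply: (kP (fun h => inner w h : R^o)); first by exists w.
  by rewrite normrZ normfV normr_id mulVf// normr_eq0.
rewrite innerZr -normr_inner expr2 mulrA mulVf ?normr_eq0// mul1r.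
by rewrite normr_id.
Qed.

(** Along an ultrafilter a family of points of a weakly compact set converges
weakly; only the functionals <., h> are needed here. *)
Lemma weakly_compact_ultra_cvg (T : Type) (U : set_system T) (M : set H)
    (w_ : T -> H) :
  UltraFilter U -> weakly_compact M -> (forall t, M (w_ t)) ->
  exists2 w, M w & forall h, inner (w_ t) h @[t --> U] --> inner w h.
Proof.
move=> UU Mc Mw.
have UM : (w_ @ U) M by exact: (@filterE _ U _ _ Mw).
have [w [Mw' wU]] := Mc (w_ @ U) _ UM.
exists w => // h A A_h.
(* a cluster point of the image of an ultrafilter is a limit point of it *)
have [//|UnA] := in_ultra_setVsetC ((fun t => inner (w_ t) h) @^-1` A) UU.
have [|y [/= nAy Ay]] := wU (~` [set y | A (inner y h)])
    ((fun y : weak_topology H => inner y h) @^-1` A) UnA.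
  exact: (@weakly_continuous_inner h w A A_h).
by [].
Qed.

End weak.

(** * Limits of approximate variational inequalities *)

Section distances.
Context {R : realType} {V : normedModType R}.
Implicit Types (a : V) (M N : set V).

Lemma set_dist_lt a N (r : \bar R) : (set_dist a N < r)%E ->
  exists2 b, N b & (`|a - b|%:E < r)%E.
Proof. by move=> /ereal_inf_lt[_ [b Nb <-] ?]; exists b. Qed.

(** [N] must be nonempty, for otherwise the distance is +oo. *)
Lemma set_dist_near_min a N e : N !=set0 -> 0 < e ->
  exists2 b, N b & (`|a - b|%:E < set_dist a N + e%:E)%E.
Proof.
move=> [b0 Nb0] e0.
have [||_ [b Nb <-] ?] := @lb_ereal_inf_adherent R
    [set `|a - b|%:E | b in N] e => //; last by exists b.
rewrite ge0_fin_numE; last by apply: le_ereal_inf_tmp => _ [b _ <-]; rewrite lee_fin.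
apply: (@le_lt_trans _ _ `|a - b0|%:E); last exact: ltry.
by apply: ereal_inf_lbound; exists b0.
Qed.

Lemma hausdorff_dist_lt M N e b : (hausdorff_dist M N < e)%E -> N b ->
  (set_dist b M < e)%E.
Proof.
rewrite /hausdorff_dist gt_max => /andP[_ NMe] Nb.
by apply: le_lt_trans NMe; apply: ereal_sup_ubound; exists b.
Qed.

Lemma closed_set_dist_cvg (T : Type) (F : set_system T) N (a_ : T -> V)
    (e_ : T -> R) a :
  ProperFilter F -> closed N -> a_ @ F --> a -> e_ @ F --> (0 : R) ->
  (forall t, (set_dist (a_ t) N <= (e_ t)%:E)%E) -> N a.
Proof.
move=> FF Nc a_a e_0 dN; apply: Nc => B /nbhs_ballP[r /= r0 rB].
have r2 : 0 < r / 2 by rewrite divr_gt0.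
near F => t.
have [|b Nb bt] := @set_dist_lt (a_ t) N (r / 2)%:E.
  rewrite (le_lt_trans (dN t))// lte_fin.
  by rewrite (le_lt_trans (ler_norm _))//; near: t; exact: cvgr0_norm_lt.
exists b; split => //; apply: rB; rewrite -ball_normE /ball_/=.
rewrite -(subrK (a_ t) a) -addrA (le_lt_trans (ler_normD _ _))//.
rewrite [r]splitr ltrD//; near: t; exact: cvgr_dist_lt.
Unshelve. all: by end_near. Qed.

End distances.

(** Approximate solutions of a variational inequality with multivalued operator
[B] pass to the limit along an ultrafilter. One limit [u] serves all [y] in [C]
at once, because it is chosen before [y]. *)
Lemma variational_ineq_limit (R : realType) (H : hilbertType R)
    (X : completeNormedModType R) (C : set H) (phi : H * X -> R)
    (B : H * X -> set H) (T : Type) (U : set_system T)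
    (x_ u_ : T -> H) (q_ : T -> X) (e_ : T -> R) (x : H) (q : X) :
  UltraFilter U -> continuous phi ->
  strict B -> weakly_compact_valued B -> H_continuous B ->
  x_ @ U --> x -> q_ @ U --> q -> (forall t, 0 < e_ t) -> e_ @ U --> (0 : R) ->
  (forall t, B (x_ t, q_ t) (u_ t)) ->
  (forall t y, C y ->
    inner (u_ t) (x_ t - y) + phi (x_ t, q_ t) - phi (y, q_ t) <= e_ t) ->
  exists2 u, B (x, q) u &
    forall y, C y -> inner u (x - y) + phi (x, q) - phi (y, q) <= 0.
Proof.
move=> UU phic Bs Bw Bc x_x q_q e_gt0 e_0 Bu vi.
(* w_ t is an almost nearest point to u_ t in B (x, q) *)
have /choice[w_ /all_and2[Bw_ w_u]] : forall t, exists w, B (x, q) w /\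
    (`|u_ t - w|%:E < set_dist (u_ t) (B (x, q)) + (e_ t)%:E)%E.
  by move=> t; have [w] := set_dist_near_min (u_ t) (Bs (x, q)) (e_gt0 t);
    exists w.
have uw0 : u_ t - w_ t @[t --> U] --> (0 : H).
  apply/cvgr0Pnorm_lt => e e0.
  have e2 : 0 < e / 2 by rewrite divr_gt0.
  have [d d0 dB] := Bc (x, q) (e / 2) e2.
  near=> t; rewrite -lte_fin (lt_le_trans (w_u t))// [e]splitr EFinD leeD//.
    apply/ltW; apply: (hausdorff_dist_lt _ (Bu t)); apply: dB.
    near: t; apply: cvgr_dist_lt => //; exact: cvg_pair.
  rewrite lee_fin (le_trans (ler_norm _))//.
  by near: t; apply: cvgr0_norm_le.
have [u Bu' wu] := weakly_compact_ultra_cvg UU (Bw (x, q)) Bw_.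
have [k kB] := weakly_compact_normr_bounded (Bw (x, q)).
exists u => // y Cy.
have xy : x_ t - y @[t --> U] --> x - y by apply: cvgB => //; exact: cvg_cst.
have uxy : inner (u_ t) (x_ t - y) @[t --> U] --> inner u (x - y).
  have -> : (fun t => inner (u_ t) (x_ t - y)) = (fun t => inner (w_ t) (x - y)
      + (inner (u_ t - w_ t) (x_ t - y) + inner (w_ t) (x_ t - x))).
    apply/funext => t; rewrite !(innerBl, innerBr); lra.
  rewrite -[X in _ --> X]addr0 -[X in _ --> _ + X]addr0.
  apply: cvgD; first exact: wu.
  apply: cvgD; apply/norm_cvg0P.
    apply: (@squeeze_cvgr _ _ _ _ (cst 0) (fun t => `|u_ t - w_ t| * `|x_ t - y|)).
    - by near=> t; rewrite normr_ge0 normr_inner_le.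
    - exact: cvg_cst.
    - rewrite -(mul0r `|x - y|) -(@normr0 _ H).
      by apply: cvgM; apply: cvg_norm.
  apply: (@squeeze_cvgr _ _ _ _ (cst 0) (fun t => k * `|x_ t - x|)).
  - near=> t; rewrite normr_ge0 (le_trans (normr_inner_le _ _))//.
    by rewrite ler_wpM2r// kB.
  - exact: cvg_cst.
  - rewrite -(mulr0 k) -(@normr0 _ H) -(subrr x).
    apply: cvgM; first exact: cvg_cst.
    by apply: cvg_norm; apply: cvgB => //; exact: cvg_cst.
have phic' (z_ : T -> H) z : z_ @ U --> z ->
    phi (z_ t, q_ t) @[t --> U] --> phi (z, q).
  by move=> z_z; exact: (cvg_comp _ _ (cvg_pair z_z q_q) (phic (z, q))).
have vil : inner (u_ t) (x_ t - y) + phi (x_ t, q_ t) - phi (y, q_ t)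
    @[t --> U] --> inner u (x - y) + phi (x, q) - phi (y, q).
  apply: cvgB; last by apply: phic'; exact: cvg_cst.
  by apply: cvgD => //; exact: phic'.
rewrite -[leLHS]subr0; apply: (cvgr_to_le (cvgB vil e_0)).
by near=> t; rewrite subr_le0; exact: vi.
Unshelve. all: by end_near. Qed.

(** * Ultrafilters, subsequences and finite covers *)

Section compactness.

Lemma ultra_bigcup (T : Type) (U : set_system T) n (M_ : 'I_n -> set T) :
  UltraFilter U -> U (\bigcup_i M_ i) -> exists i, U (M_ i).
Proof.
move=> UU UM; apply: contrapT => /forallNP nM.
have : U [set t | forall i, (~` M_ i) t].
  apply: filter_forall => i.
  by have [/nM//|] := in_ultra_setVsetC (M_ i) UU.
by move=> /(filterI UM)/filter_ex[t [[i _ Mit] /(_ i)]].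
Qed.

(** If, for every e > 0, finitely many sets of diameter at most e cover a set of
the ultrafilter, then the family is Cauchy along it. *)
Lemma ultra_totally_bounded_cvg (R : realType) (V : completeNormedModType R)
    (T : Type) (U : set_system T) (x_ : T -> V) :
  UltraFilter U ->
  (forall e : R, 0 < e -> exists n (M_ : 'I_n -> set T), U (\bigcup_i M_ i) /\
    forall i s t, M_ i s -> M_ i t -> `|x_ s - x_ t| < e) ->
  exists x : V, x_ @ U --> x.
Proof.
move=> UU tb; suff /cauchy_cvgP/cvg_ex : cauchy (x_ @ U) by [].
apply: cauchy_exP => e /tb[n [M_ [/ultra_bigcup[i UMi] Me]]].
have [s Ms] := filter_ex UMi.
exists (x_ s); apply: (@filterS _ U _ _ _ _ UMi) => t Mt.
by rewrite /= -ball_normE /ball_/=; exact: Me Ms Mt.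
Qed.

(** The filter [U] witnesses that [z] is a cluster point of [z_]. *)
Lemma subseq_cvg_of_cluster (R : realType) (V : pseudoMetricType R)
    (U : set_system nat) (z_ : nat -> V) (z : V) :
  ProperFilter U -> \oo `<=` U -> z_ @ U --> z ->
  exists2 f : nat -> nat, {homo f : m n / (m < n)%N} & (z_ \o f) @ \oo --> z.
Proof.
move=> UF ooU z_z.
(* g (n, k) is an index beyond k whose term is within 1 / (n + 1) of z *)
have /choice[g gP] : forall nk : nat * nat,
    exists m, (nk.2 < m)%N /\ ball z nk.1.+1%:R^-1 (z_ m).
  move=> [n k]; suff : U [set m | (k < m)%N /\ ball z n.+1%:R^-1 (z_ m)].
    by move=> /filter_ex.
  apply: filterI; first by apply: ooU; exists k.+1.
  by apply: z_z; apply: nbhsx_ballx; rewrite invr_gt0.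
pose f := fix f n := if n is n'.+1 then g (n, f n') else g (0, 0)%N.
exists f.
  apply: homo_ltn; first exact: ltn_trans.
  by move=> n; have [] := gP (n.+1, f n).
have fz n : ball z n.+1%:R^-1 (z_ (f n)).
  by case: n => [|n]; [have [] := gP (0, 0)%N|have [] := gP (n.+1, f n)].
apply/cvg_ballP => e e0; near=> n.
apply: le_ball (fz n); apply: ltW.
by near: n; exact: (near_infty_natSinv_lt (PosNum e0)).
Unshelve. all: by end_near. Qed.

(** If no [S_ n] has a finite cover by balls of radius [r], then points of the
successive [S_ n] can be chosen outside of the balls around the earlier ones. *)
Lemma exists_separated_seq (R : realType) (V : pseudoMetricType R)
    (S_ : nat -> set V) (r : R) :
  (forall n (s : seq V), ~ S_ n `<=` \bigcup_(y in [set` s]) ball y r) ->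
  exists z_ : nat -> V, (forall n, S_ n (z_ n)) /\
    forall m n, (m < n)%N -> ~ ball (z_ m) r (z_ n).
Proof.
move=> nS.
(* g (n, s) is a point of S_ n far from the list s; l n lists the first n points *)
have /choice[g gP] : forall ns : nat * seq V, exists z, S_ ns.1 z /\
    forall y, y \in ns.2 -> ~ ball y r z.
  move=> [n s]; have /existsNP[z /not_implyP[Sz nz]] := nS n s.
  by exists z; split=> // y ys yz; apply: nz; exists y.
pose l := fix l n := if n is n'.+1 then g (n', l n') :: l n' else [::].
exists (fun n => g (n, l n)); split=> [n|m n mn]; first by have [] := gP (n, l n).
have [_ /(_ (g (m, l m)))] := gP (n, l n); apply.
elim: n mn => // n IHn; rewrite ltnS leq_eqVlt => /predU1P[->|/IHn mn] /=.
  by rewrite inE eqxx.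
by rewrite inE mn orbT.
Qed.

End compactness.

(** * Measure of noncompactness *)

Section kuratowski.
Context {R : realType} (V : zmodType) (nrm : V -> R).
Implicit Type M : set V.

Lemma diam_lt M (e : R) a b : (diam nrm M < e%:E)%E -> M a -> M b ->
  nrm (a - b) < e.
Proof.
move=> Me Ma Mb; rewrite -lte_fin; apply: le_lt_trans Me.
by apply: ereal_sup_ubound; exists (a, b).
Qed.

Lemma kuratowski_ge0 M : (0 <= kuratowski nrm M)%E.
Proof.
by apply: le_ereal_inf_tmp => _ [e [e0 _] <-]; rewrite lee_fin ltW.
Qed.

Lemma kuratowski_lt M (e : R) : (kuratowski nrm M < e%:E)%E ->
  exists n (M_ : 'I_n -> set V),
    M `<=` \bigcup_i M_ i /\ forall i, (diam nrm (M_ i) < e%:E)%E.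
Proof.
move=> /ereal_inf_lt[_ [e' [_ [n [M_ [MM dM]]]] <-] e'e].
by exists n, M_; split=> // i; exact: lt_trans e'e.
Qed.

Lemma kuratowski_le M (e : R) n (M_ : 'I_n -> set V) : 0 < e ->
  M `<=` \bigcup_i M_ i -> (forall i, (diam nrm (M_ i) < e%:E)%E) ->
  (kuratowski nrm M <= e%:E)%E.
Proof.
by move=> e0 MM dM; apply: ereal_inf_lbound; exists e => //; split=> //; exists n, M_.
Qed.

End kuratowski.

(** Convergence to 0 as both arguments tend to 0 from above, in terms of bounds. *)
Lemma cvg_within_quadrant (R : realType) (f : R * R -> \bar R) :
  (forall x, (0 <= f x)%E) ->
  (f @ within [set x : R * R | 0 < x.1 /\ 0 < x.2] (nbhs ((0, 0) : R * R))
     --> 0%E) <->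
  (forall e : R, 0 < e -> exists2 r, 0 < r &
    forall a b, 0 < a < r -> 0 < b < r -> (f (a, b) < e%:E)%E).
Proof.
move=> f0; split=> [f_0 e e0|fe].
  have : nbhs (0%E : \bar R) [set y | (y < e%:E)%E].
    apply/nbhs_EFin/nbhs_ballP; exists e => //= y.
    by rewrite -ball_normE /ball_/= sub0r normrN lte_fin => /ltr_normlW.
  move=> /f_0/nbhs_ballP[r /= r0 rf]; exists r => // a b /andP[a0 ar] /andP[b0 br].
  apply: (rf (a, b)) => //; split; rewrite -ball_normE /ball_/= sub0r normrN.
    by rewrite gtr0_norm.
  by rewrite gtr0_norm.
move=> A /nbhs_EFin/nbhs_ballP[e /= e0 eA].
have [r r0 rf] := fe _ e0.
apply/nbhs_ballP; exists r => //= -[a b] [/= ra rb] [/= a0 b0].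
move: ra rb; rewrite -ball_normE /ball_/= !sub0r !normrN !gtr0_norm// => ar br.
have := rf a b; rewrite a0 b0 => /(_ ar br); move: (f0 (a, b)).
case: (f (a, b)) => [y|//|//]; rewrite lee_fin lte_fin => y0 ye; apply: eA.
by rewrite -ball_normE /ball_/= sub0r normrN ger0_norm.
Qed.

Section hprod_norm.
Context {R : realType} {H1 H2 : hilbertType R}.
Implicit Types z w : H1 * H2.

Lemma normr_fst_le z : `|z.1| <= hprod_norm z.
Proof.
rewrite -[leLHS]normr_id -sqrtr_sqr ler_sqrt ?addr_ge0 ?exprn_ge0//.
by rewrite lerDl exprn_ge0.
Qed.

Lemma normr_snd_le z : `|z.2| <= hprod_norm z.
Proof.
rewrite -[leLHS]normr_id -sqrtr_sqr ler_sqrt ?addr_ge0 ?exprn_ge0//.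
by rewrite lerDr exprn_ge0.
Qed.

Lemma hprod_norm_le z : hprod_norm z <= `|z.1| + `|z.2|.
Proof.
rewrite -[leRHS]ger0_norm ?addr_ge0// -sqrtr_sqr ler_sqrt ?exprn_ge0 ?addr_ge0//.
by rewrite sqrrD lerD2r lerDl mulrn_wge0 ?mulr_ge0.
Qed.

(** The balls of the product are those of the maximum norm, which explains the
factor 4 instead of 2. *)
Lemma diam_ball_le z (r : R) : (diam (@hprod_norm R H1 H2) (ball z r) <= (4 * r)%:E)%E.
Proof.
apply: ge_ereal_sup => _ [[[a1 a2] [b1 b2]] [[/= a1z a2z] [/= b1z b2z]] <-].
rewrite lee_fin (le_trans (hprod_norm_le _))//=.
move: a1z a2z b1z b2z; rewrite -!ball_normE /ball_/= => a1z a2z b1z b2z.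
have := ler_distD z.1 a1 b1; have := ler_distD z.2 a2 b2.
rewrite (distrC a1 z.1) (distrC a2 z.2); lra.
Qed.

End hprod_norm.

(** * Approximate solutions and approximating sequences *)

Section approximate_solutions.
Context {R : realType} {H1 H2 : hilbertType R} {X : completeNormedModType R}.
Variables (C : set H1) (Q : set H2).
Variables (phi : H1 * X -> R) (psi : H2 * X -> R).
Variables (B1 : H1 * X -> set H1) (B2 : H2 * X -> set H2).
Variable A : {linear H1 -> H2}.

Local Notation sol := (PSMVIP_sol C Q phi psi B1 B2 A).
Local Notation approx := (approx_sol C Q phi psi B1 B2 A).
Local Notation gas := (gen_approx_seq C Q phi psi B1 B2 A).
Local Notation ineqs := (approx_ineqs C Q phi psi A).

Lemma approx_ineqs_le q (e e' : R) z u v : e <= e' ->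
  ineqs q e z u v -> ineqs q e' z u v.
Proof.
move=> ee' [zC zQ zA [vi1 vi2]]; split.
- by rewrite (le_trans zC)// lee_fin.
- by rewrite (le_trans zQ)// lee_fin.
- exact: le_trans ee'.
- by split=> [x Cx|y Qy]; rewrite (le_trans _ ee')// (vi1, vi2).
Qed.

Lemma approx_sol_le p (d d' e e' : R) : d <= d' -> e <= e' ->
  approx p d e `<=` approx p d' e'.
Proof.
move=> dd' ee' z [q pq [u [v [Buv zuv]]]]; exists q; first exact: le_trans dd'.
by exists u, v; split=> //; exact: approx_ineqs_le zuv.
Qed.

Lemma sol_sub_approx_sol p (d e : R) : 0 < d -> 0 < e ->
  sol p `<=` approx p d e.
Proof.
move=> d0 e0 z [u [v [Buv [Cz Qz zA vi]]]]; exists p.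
  by rewrite /closed_ball_/= subrr normr0 ltW.
exists u, v; split=> //; apply: approx_ineqs_le (ltW e0) _; split=> //.
- by apply: ereal_inf_lbound; exists z.1 => //; rewrite subrr normr0.
- by apply: ereal_inf_lbound; exists z.2 => //; rewrite subrr normr0.
- by rewrite zA subrr normr0.
Qed.

Lemma gen_approx_seq_approx_sol p p_ z_ (d e : R) : gas p p_ z_ ->
  0 < d -> 0 < e -> \forall n \near \oo, approx p d e (z_ n).
Proof.
move=> [p_p [u_ [v_ [e_ [Buv e_gt0 e_0 zuv]]]]] d0 e0; near=> n.
exists (p_ n); first by near: n; exact: cvgr_dist_le.
exists (u_ n), (v_ n); split=> //; apply: approx_ineqs_le (zuv n).
by rewrite (le_trans (ler_norm _))//; near: n; exact: cvgr0_norm_le.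
Unshelve. all: by end_near. Qed.

Lemma approx_sol_gen_approx_seq p (z_ : nat -> H1 * H2) :
  (forall n, approx p n.+1%:R^-1 n.+1%:R^-1 (z_ n)) ->
  exists p_, gas p p_ z_.
Proof.
move=> zS.
have /choice[q_ /all_and2[pq /choice[u_ /choice[v_ /all_and2[Buv zuv]]]]] :
    forall n, exists q, `|p - q| <= n.+1%:R^-1 /\ exists u v,
      (B1 ((z_ n).1, q) u /\ B2 ((z_ n).2, q) v) /\
      ineqs q n.+1%:R^-1 (z_ n) u v.
  by move=> n; have [q pq [u [v ?]]] := zS n; exists q; split=> //; exists u, v.
have inv_0 : (fun n => n.+1%:R^-1 : R) @ \oo --> (0 : R) by exact: cvg_harmonic.
exists q_; split.
  apply/cvgrPdist_le => e e0; near=> n.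
  rewrite (le_trans (pq n))// (le_trans (ler_norm _))//.
  by near: n; exact: cvgr0_norm_le.
by exists u_, v_, (fun n => n.+1%:R^-1).
Unshelve. all: by end_near. Qed.

Hypotheses (C_closed : closed C) (Q_closed : closed Q).
Hypotheses (phi_cont : continuous phi) (psi_cont : continuous psi).
Hypotheses (B1_strict : strict B1) (B1_wcompact : weakly_compact_valued B1)
  (B1_Hcont : H_continuous B1).
Hypotheses (B2_strict : strict B2) (B2_wcompact : weakly_compact_valued B2)
  (B2_Hcont : H_continuous B2).
Hypothesis A_bounded : bounded_linear A.

(** The components of [z_] converge along an ultrafilter that refines the
convergence at infinity. *)
Lemma gen_approx_seq_limit p p_ z_ (U : set_system nat) x y :
  UltraFilter U -> \oo `<=` U -> gas p p_ z_ ->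
  (z_ n).1 @[n --> U] --> x -> (z_ n).2 @[n --> U] --> y -> sol p (x, y).
Proof.
move=> UU ooU [p_p [u_ [v_ [e_ [Buv e_gt0 e_0 zuv]]]]] zx zy.
have p_pU : p_ @ U --> p by move=> N /p_p/ooU.
have e_0U : e_ @ U --> (0 : R) by move=> N /e_0/ooU.
have [u B1u viu] : exists2 u, B1 (x, p) u &
    forall x', C x' -> inner u (x - x') + phi (x, p) - phi (x', p) <= 0.
  apply: (variational_ineq_limit (u_ := u_) UU phi_cont B1_strict B1_wcompact B1_Hcont
    zx p_pU e_gt0 e_0U) => n; first by have [] := Buv n.
  by have [_ _ _ []] := zuv n.
have [v B2v viv] : exists2 v, B2 (y, p) v &
    forall y', Q y' -> inner v (y - y') + psi (y, p) - psi (y', p) <= 0.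
  apply: (variational_ineq_limit (u_ := v_) UU psi_cont B2_strict B2_wcompact B2_Hcont
    zy p_pU e_gt0 e_0U) => n; first by have [] := Buv n.
  by have [_ _ _ []] := zuv n.
exists u, v; split=> //; split=> //=.
- by apply: (closed_set_dist_cvg _ C_closed zx e_0U) => n; have [] := zuv n.
- by apply: (closed_set_dist_cvg _ Q_closed zy e_0U) => n; have [] := zuv n.
- have A_cont : continuous A.
    have [k kA] := A_bounded.
    apply: bounded_linear_continuous; apply/linear_boundedP.
    by near=> r => w; rewrite (le_trans (kA w))// ler_wpM2r.
  have Azx : A (z_ n).1 @[n --> U] --> A x.
    by apply: (cvg_comp _ _ zx); exact: A_cont.
  have yAx : `|(z_ n).2 - A (z_ n).1| @[n --> U] --> `|y - A x|.
    by apply: cvg_norm; exact: cvgB.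
  apply/eqP; rewrite -subr_eq0 -normr_le0 -[leLHS]subr0.
  apply: (cvgr_to_le (cvgB yAx e_0U)); near=> n.
  by rewrite /= subr_le0; have [] := zuv n.
Unshelve. all: by end_near. Qed.

Lemma gen_approx_seq_subseq_cvg p p_ z_ :
  (forall e : R, 0 < e -> exists d0 e0, [/\ 0 < d0, 0 < e0 &
    (kuratowski (@hprod_norm R H1 H2) (approx p d0 e0) < e%:E)%E]) ->
  gas p p_ z_ ->
  exists f : nat -> nat, {homo f : m n / (m < n)%N} /\
    exists2 z, sol p z & (z_ \o f) @ \oo --> z.
Proof.
move=> kur zgas.
have [U [UU ooU]] := ultraFilterLemma (_ : ProperFilter (\oo : set_system nat)).
have cover e : 0 < e -> exists n (M_ : 'I_n -> set nat), U (\bigcup_i M_ i) /\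
    forall i s t, M_ i s -> M_ i t -> hprod_norm (z_ s - z_ t) < e.
  move=> /kur[d0 [e0 [d0_gt0 e0_gt0 /kuratowski_lt[n [M_ [zM dM]]]]]].
  exists n, (fun i => z_ @^-1` M_ i); split; last first.
    by move=> i s t; exact: diam_lt.
  apply: ooU; apply: filterS (gen_approx_seq_approx_sol zgas d0_gt0 e0_gt0).
  by move=> m /zM[i _ Mi]; exists i.
have [x zx] : exists x : H1, (z_ n).1 @[n --> U] --> x.
  apply: ultra_totally_bounded_cvg => e /cover[n [M_ [UM Me]]].
  exists n, M_; split=> // i s t Ms Mt.
  exact: le_lt_trans (normr_fst_le (z_ s - z_ t)) (Me i s t Ms Mt).
have [y zy] : exists y : H2, (z_ n).2 @[n --> U] --> y.
  apply: ultra_totally_bounded_cvg => e /cover[n [M_ [UM Me]]].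
  exists n, M_; split=> // i s t Ms Mt.
  exact: le_lt_trans (normr_snd_le (z_ s - z_ t)) (Me i s t Ms Mt).
have zxy : z_ @ U --> (x, y).
  rewrite (_ : z_ = fun n => ((z_ n).1, (z_ n).2)); first exact: cvg_pair.
  by apply/funext => n; case: (z_ n).
have [f f_incr zf] := subseq_cvg_of_cluster _ ooU zxy.
exists f; split=> //; exists (x, y) => //.
exact: (gen_approx_seq_limit _ ooU zgas zx zy).
Qed.

End approximate_solutions.

(** * The characterization of well-posedness *)

Theorem theorem15 (R : realType) (H1 H2 : hilbertType R)
    (X : completeNormedModType R)
    (C : set H1) (Q : set H2)
    (phi : H1 * X -> R) (psi : H2 * X -> R)
    (B1 : H1 * X -> set H1) (B2 : H2 * X -> set H2)
    (A : {linear H1 -> H2}) :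
  finite_dimensional X ->
  C !=set0 -> closed C -> convex_set C ->
  Q !=set0 -> closed Q -> convex_set Q ->
  continuous phi -> continuous psi ->
  strict B1 -> weakly_compact_valued B1 -> H_continuous B1 ->
  strict B2 -> weakly_compact_valued B2 -> H_continuous B2 ->
  bounded_linear A ->
  LP_well_posed_gen C Q phi psi B1 B2 A <->
  (forall p : X,
    (forall d e : R, 0 < d -> 0 < e ->
      approx_sol C Q phi psi B1 B2 A p d e !=set0) /\
    (fun de : R * R => kuratowski (@hprod_norm R H1 H2)
                         (approx_sol C Q phi psi B1 B2 A p de.1 de.2))
      @ within [set de : R * R | 0 < de.1 /\ 0 < de.2] (nbhs ((0, 0) : R * R))
      --> 0%E).
Proof.
move=> _ _ Ccl _ _ Qcl _ phic psic B1s B1w B1c B2s B2w B2c Ab.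
have inv_gt0 n : 0 < n.+1%:R^-1 :> R by rewrite invr_gt0.
split=> [wp p|kur p].
  have [[z0 z0sol] subseq] := wp p; split=> [d e d0 e0|].
    by exists z0; exact: (sol_sub_approx_sol d0 e0).
  apply/cvg_within_quadrant => [de|e e0]; first exact: kuratowski_ge0.
  (* a cover by balls of radius r has sets of diameter at most 4 r < e / 2 *)
  pose r := e / 16; have r0 : 0 < r by rewrite divr_gt0.
  have [n [s ns]] : exists n (s : seq (H1 * H2)),
      approx_sol C Q phi psi B1 B2 A p n.+1%:R^-1 n.+1%:R^-1 `<=`
        \bigcup_(y in [set` s]) ball y r.
    apply: contrapT => /forallNP noc.
    have [|z_ [/approx_sol_gen_approx_seq[p_ zgas] zsep]] := @exists_separated_seq
        R _ (fun n => approx_sol C Q phi psi B1 B2 A p n.+1%:R^-1 n.+1%:R^-1) r.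
      by move=> n s ns; apply: (noc n); exists s.
    (* two late terms of a convergent subsequence are within r *)
    have [f [f_incr [z _ zf]]] := subseq _ zgas.1 z_ zgas.
    have r2 : 0 < r / 2 by rewrite divr_gt0.
    have [N _ Nz] : \forall n \near \oo, ball z (r / 2) ((z_ \o f) n).
      by move/cvg_ballP : zf; apply.
    apply: (zsep (f N) (f N.+1)); first exact: f_incr.
    by apply: (ball_splitr (z := z)); apply: Nz => /=.
  exists n.+1%:R^-1 => // a b /andP[a0 an] /andP[b0 bn].
  apply: (@le_lt_trans _ _ (e / 2)%:E); last first.
    by rewrite lte_fin ltr_pdivrMr// mulr2n mulrDr mulr1 ltrDl.
  apply: (@kuratowski_le _ _ _ _ _ (size s)
      (fun i => ball (nth (0, 0) s i) r)); first by rewrite divr_gt0.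
    move=> z /(approx_sol_le (ltW an) (ltW bn))/ns[y /= ys yz].
    have ys' : (index y s < size s)%N by rewrite index_mem.
    by exists (Ordinal ys') => //=; rewrite nth_index.
  move=> i; apply: le_lt_trans (diam_ball_le _ _) _.
  by rewrite lte_fin /r; lra.
have kurp e : 0 < e -> exists d0 e0, [/\ 0 < d0, 0 < e0 &
    (kuratowski (@hprod_norm R H1 H2)
       (approx_sol C Q phi psi B1 B2 A p d0 e0) < e%:E)%E].
  have [_ /cvg_within_quadrant kur0] := kur p.
  move=> /kur0[|r r0 rkur]; first by move=> de; exact: kuratowski_ge0.
  exists (r / 2), (r / 2); rewrite divr_gt0//; split=> //.
  by apply: rkur; rewrite divr_gt0//= ltr_pdivrMr// mulr2n mulrDr mulr1 ltrDl.
split; last first.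
  by move=> p_ _ z_; exact: gen_approx_seq_subseq_cvg.
have /choice[z_ /approx_sol_gen_approx_seq[p_ zgas]] : forall n, exists z,
    approx_sol C Q phi psi B1 B2 A p n.+1%:R^-1 n.+1%:R^-1 z.
  by move=> n; have [+ _] := kur p; apply.
have [f [_ [z zsol _]]] := gen_approx_seq_subseq_cvg Ccl Qcl phic psic
  B1s B1w B1c B2s B2w B2c Ab kurp zgas.
by exists z.
Qed.
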